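(* Let $\rho>0$ and suppose $\theta_0=0$, so that the flat surface $\mathcal{S}_0=\{(0,y,z):-1\le y\le1,\ 0\le z\le\rho\}$ belongs to $\mathcal{A}$ (and is a critical point of $E$). Then $\mathcal{S}_0$ satisfies the second-variation stability condition if and only if $$1\le\frac{\pi}{\rho}\tanh\Big(\frac{\pi}{\rho}\Big).$$
   Context: Let $\mathcal{C}=\{(x,y,z)\in\mathbb{R}^3: x^2+y^2=1,\ 0\le z\le\rho\}$, let $\mathbf{z}=(0,0,1)$, and let $\mathbf{r}(x,y,z)=(x,y,0)$ be the unit normal on $\mathcal{C}$ pointing away from its axis. With $\theta_0=0$ the wires are $\mathcal{W}_1=\{(0,s,0):|s|\le1\}$ and $\mathcal{W}_2=\{(0,s,\rho):|s|\le 1\}$; $\mathcal{W}=\mathcal{W}_1\cup\mathcal{W}_2$. $\mathcal{A}$ is the collection of all surfaces $\mathcal{S}$ such that (1) there is an injective $f\in C^2(\mathcal{S}_0,\mathbb{R}^3)$ with $f(\mathcal{S}_0)=\mathcal{S}$; (2) $\partial\mathcal{S}$ consists of $\mathcal{W}$ and two curves lying on $\mathcal{C}$, i.e. $\mathcal{W}\subset\partial\mathcal{S}$ and $\mathcal{Y}:=\partial\mathcal{S}\setminus\mathcal{W}\subset\mathcal{C}$. Surfaces are understood to be regular, so that $\mathcal{S}\in\mathcal{A}$ is oriented by a unit normal field $\mathbf{n}$ of class $C^1$. Along $\partial\mathcal{S}$, $\mathbf{t}$ is the unit tangent. $\nabla_{\mathcal{S}}$ denotes the surface gradient (gradient of the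 extension that is constant in the normal direction) and $\mathrm{div}_{\mathcal{S}}=\mathrm{tr}\,\nabla_{\mathcal{S}}$. The functional is $E(\mathcal{S})=\int_{\mathcal{S}}\sigma\,\mathrm{da}$ with $\sigma>0$ constant. For $\mathcal{S}\in\mathcal{A}$ put $$V=\{\mathbf{v}\in C^2(\mathcal{S},\mathbb{R}^3): \mathbf{v}=(\mathbf{v}\cdot\mathbf{t})\mathbf{t}\text{ on }\mathcal{W},\ \mathbf{v}\cdot\mathbf{r}=0\text{ on }\mathcal{Y}\}.$$ Critical point: $\int_{\mathcal{S}}\sigma\,\mathrm{div}_{\mathcal{S}}\mathbf{v}\,\mathrm{da}=0$ for all $\mathbf{v}\in V$. Second-variation stability condition for $\mathcal{S}$: consider one-parameter families $f(t,\cdot)$ of injective $C^2$ maps $\mathcal{S}_0\to\mathbb{R}^3$, $C^2$ in $t$ near $0$, with $f(0,\mathcal{S}_0)=\mathcal{S}$ and $f(t,\mathcal{S}_0)\in\mathcal{A}$, points on the wires remaining on the wires and points of $\mathcal{Y}$ remaining on $\mathcal{C}$. With initial velocity $\mathbf{v}$ and initial acceleration $\mathbf{a}$ (viewed as fields on $\mathcal{S}$), one has $\mathbf{v}\in V$, $\mathbf{a}=(\mathbf{a}\cdot\mathbf{t})\mathbf{t}$ on $\mathcal{W}$, $\mathbf{a}\cdot\mathbf{r}=|\mathbf{v}\cdot\mathbf{z}|^2-|\mathbf{v}|^2$ on $\mathcal{Y}$, and the second variation of $E$ is $$\frac{d^2}{dt^2}E(f(t,\mathcal{S}_0))\Big|_{t=0}=\int_{\mathcal{S}}\sigma\big[|(\nabla_{\mathcal{S}}\mathbf{v})^{\top}\mathbf{n}|^2+(\mathrm{div}_{\mathcal{S}}\mathbf{v})^2-\mathrm{tr}((\nabla_{\mathcal{S}}\mathbf{v})^2)+\mathrm{div}_{\mathcal{S}}\mathbf{a}\big]\,\mathrm{da}.$$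 $\mathcal{S}$ satisfies the second-variation stability condition if this quantity is $\ge0$ for all $\mathbf{v}\in V$ (with $\mathbf{a}$ subject to the stated constraints). *)

(* Defs.v *)
From Stdlib Require Import Reals Lra.
From Coquelicot Require Import Coquelicot.
Open Scope R_scope.

Record vec3 : Type := mkvec { vx : R; vy : R; vz : R }.

Definition vadd (u v : vec3) : vec3 :=
  mkvec (vx u + vx v) (vy u + vy v) (vz u + vz v).
Definition vscale (c : R) (u : vec3) : vec3 :=
  mkvec (c * vx u) (c * vy u) (c * vz u).
Definition vdot (u v : vec3) : R := vx u * vx v + vy u * vy v + vz u * vz v.
Definition vcross (u v : vec3) : vec3 :=
  mkvec (vy u * vz v - vz u * vy v)
        (vz u * vx v - vx u * vz v)
        (vx u * vy v - vy u * vx v).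
Definition vnorm (u : vec3) : R := sqrt (vdot u u).

Definition e_x : vec3 := mkvec 1 0 0.
Definition e_y : vec3 := mkvec 0 1 0.
Definition e_z : vec3 := mkvec 0 0 1.

(* Linear maps of R^3; all of these operations are used on linear maps only. *)
Definition trace (L : vec3 -> vec3) : R :=
  vdot (L e_x) e_x + vdot (L e_y) e_y + vdot (L e_z) e_z.
Definition transpose (L : vec3 -> vec3) (u : vec3) : vec3 :=
  mkvec (vdot u (L e_x)) (vdot u (L e_y)) (vdot u (L e_z)).

(* The reference surface {0} x [-1,1] x [0,rho] is identified with the
   rectangle [-1,1] x [0,rho] of its coordinates (y,z). *)
Definition in_rect (rho y z : R) : Prop := -1 <= y <= 1 /\ 0 <= z <= rho.
Definition on_rect_boundary (rho y z : R) : Prop :=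
  in_rect rho y z /\ (y = -1 \/ y = 1 \/ z = 0 \/ z = rho).

(* C^2 up to the boundary of the closed rectangle: an element of
   C^2([-1,1] x [0,rho], R^3) is represented by a C^2 extension to the plane,
   which always exists.  Values and derivatives are only ever used at points of
   the rectangle, where they do not depend on the choice of the extension. *)
Definition C2_scalar (g : R -> R -> R) : Prop := forall y z, ex_diff_n g 2 y z.
Definition C2_field (v : R -> R -> vec3) : Prop :=
  C2_scalar (fun y z => vx (v y z)) /\
  C2_scalar (fun y z => vy (v y z)) /\
  C2_scalar (fun y z => vz (v y z)).

Definition dy (v : R -> R -> vec3) (y z : R) : vec3 :=
  mkvec (Derive (fun s => vx (v s z)) y)
        (Derive (fun s => vy (v s z)) y)
        (Derive (fun s => vz (v s z)) y).
Definition dz (v : R -> R -> vec3) (y z : R) : vec3 :=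
  mkvec (Derive (fun s => vx (v y s)) z)
        (Derive (fun s => vy (v y s)) z)
        (Derive (fun s => vz (v y s)) z).

(* The cylinder, and the wires for theta_0 = 0. *)
Definition cylinder (rho : R) (p : vec3) : Prop :=
  vx p ^ 2 + vy p ^ 2 = 1 /\ 0 <= vz p <= rho.
Definition radial (p : vec3) : vec3 := mkvec (vx p) (vy p) 0.
Definition wire1 (p : vec3) : Prop :=
  exists s : R, Rabs s <= 1 /\ p = mkvec 0 s 0.
Definition wire2 (rho : R) (p : vec3) : Prop :=
  exists s : R, Rabs s <= 1 /\ p = mkvec 0 s rho.
Definition wires (rho : R) (p : vec3) : Prop := wire1 p \/ wire2 rho p.

(* The unit tangent t of the boundary enters only through (u.t)t on the wires.
   There it is the direction of the wires, up to a sign that cancels; at the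
   four end points of the wires it is likewise the tangent of the wire. *)
Definition wire_tangent : vec3 := e_y.

Section Parametrized_surface.
Variable f : R -> R -> vec3.

Definition normal_vector (y z : R) : vec3 := vcross (dy f y z) (dz f y z).
Definition area_density (y z : R) : R := vnorm (normal_vector y z).
Definition unit_normal (y z : R) : vec3 :=
  vscale (/ area_density y z) (normal_vector y z).

(* With N = f_y x f_z, the vectors (f_z x N)/|N|^2 and (N x f_y)/|N|^2 are
   the basis of the tangent plane dual to (f_y, f_z). *)
Definition dual_y (y z : R) : vec3 :=
  let N := normal_vector y z in
  vscale (/ vdot N N) (vcross (dz f y z) N).
Definition dual_z (y z : R) : vec3 :=
  let N := normal_vector y z in
  vscale (/ vdot N N) (vcross N (dy f y z)).

(* Fields on the surface are given as functions of the parameters (y,z).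
   The extension of v constant in the normal direction satisfies
   v~ (f y z + s n) = v y z, so its derivative at f y z sends f_y to v_y,
   f_z to v_z and n to 0 (see surface_grad_spec).  The matrix convention is
   (grad v)_ij = d_j v_i, i.e. surface_grad v y z u is the derivative of v
   in the direction u. *)
Definition surface_grad (v : R -> R -> vec3) (y z : R) (u : vec3) : vec3 :=
  vadd (vscale (vdot u (dual_y y z)) (dy v y z))
       (vscale (vdot u (dual_z y z)) (dz v y z)).
Definition surface_div (v : R -> R -> vec3) (y z : R) : R :=
  trace (surface_grad v y z).

(* The integrands below are continuous on the closed rectangle for a C^2
   regular parametrization and C^2 fields, so the iterated Riemann integral
   is the surface integral. *)
Definition surface_integral (rho : R) (g : R -> R -> R) : R :=
  RInt (fun z => RInt (fun y => g y z * area_density y z) (-1) 1) 0 rho.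

Definition surface_boundary (rho : R) (p : vec3) : Prop :=
  exists y z, on_rect_boundary rho y z /\ f y z = p.

(* S = f(S_0) belongs to the class A, as witnessed by f. *)
Definition in_class_A_via (rho : R) (S : vec3 -> Prop) : Prop :=
  C2_field f /\
  (forall y z y' z', in_rect rho y z -> in_rect rho y' z' ->
     f y z = f y' z' -> y = y' /\ z = z') /\
  (forall y z, in_rect rho y z -> normal_vector y z <> mkvec 0 0 0) /\
  (forall p, S p <-> exists y z, in_rect rho y z /\ f y z = p) /\
  (forall p, wires rho p -> surface_boundary rho p) /\
  (forall p, surface_boundary rho p -> ~ wires rho p -> cylinder rho p).

Definition tangential_on_wires (rho : R) (v : R -> R -> vec3) : Prop :=
  forall y z, on_rect_boundary rho y z -> wires rho (f y z) ->
    v y z = vscale (vdot (v y z) wire_tangent) wire_tangent.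

(* The space V. *)
Definition admissible_velocity (rho : R) (v : R -> R -> vec3) : Prop :=
  C2_field v /\
  tangential_on_wires rho v /\
  (forall y z, on_rect_boundary rho y z -> ~ wires rho (f y z) ->
     vdot (v y z) (radial (f y z)) = 0).

Definition admissible_acceleration
    (rho : R) (v a : R -> R -> vec3) : Prop :=
  C2_field a /\
  tangential_on_wires rho a /\
  (forall y z, on_rect_boundary rho y z -> ~ wires rho (f y z) ->
     vdot (a y z) (radial (f y z)) =
       Rabs (vdot (v y z) e_z) ^ 2 - vnorm (v y z) ^ 2).

Definition critical_point (rho sigma : R) : Prop :=
  forall v, admissible_velocity rho v ->
    surface_integral rho (fun y z => sigma * surface_div v y z) = 0.

Definition second_variation (rho sigma : R) (v a : R -> R -> vec3) : R :=
  surface_integral rho (fun y z =>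
    let L := surface_grad v y z in
    sigma * (vnorm (transpose L (unit_normal y z)) ^ 2
             + surface_div v y z ^ 2
             - trace (fun u => L (L u))
             + surface_div a y z)).

Definition second_variation_stable (rho sigma : R) : Prop :=
  forall v a, admissible_velocity rho v -> admissible_acceleration rho v a ->
    0 <= second_variation rho sigma v a.

Lemma surface_grad_spec (v : R -> R -> vec3) (y z : R) :
  normal_vector y z <> mkvec 0 0 0 ->
  surface_grad v y z (dy f y z) = dy v y z /\
  surface_grad v y z (dz f y z) = dz v y z /\
  surface_grad v y z (unit_normal y z) = mkvec 0 0 0.
Proof.
intros HN.
unfold surface_grad, dual_y, dual_z, unit_normal; cbv zeta.
set (c := / area_density y z); clearbody c.
unfold normal_vector in *.
destruct (dy f y z) as [a1 a2 a3]; destruct (dz f y z) as [b1 b2 b3].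
destruct (dy v y z) as [p1 p2 p3]; destruct (dz v y z) as [q1 q2 q3].
unfold vadd, vscale, vdot, vcross in *; simpl in *.
assert (HD : (a2 * b3 - a3 * b2) * (a2 * b3 - a3 * b2)
           + (a3 * b1 - a1 * b3) * (a3 * b1 - a1 * b3)
           + (a1 * b2 - a2 * b1) * (a1 * b2 - a2 * b1) <> 0).
{ intros H; apply HN.
  pose proof (Rle_0_sqr (a2 * b3 - a3 * b2)) as S1.
  pose proof (Rle_0_sqr (a3 * b1 - a1 * b3)) as S2.
  pose proof (Rle_0_sqr (a1 * b2 - a2 * b1)) as S3.
  assert (H1 : a2 * b3 - a3 * b2 = 0)
    by (apply Rsqr_0_uniq; unfold Rsqr in *; lra).
  assert (H2 : a3 * b1 - a1 * b3 = 0)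
    by (apply Rsqr_0_uniq; unfold Rsqr in *; lra).
  assert (H3 : a1 * b2 - a2 * b1 = 0)
    by (apply Rsqr_0_uniq; unfold Rsqr in *; lra).
  now rewrite H1, H2, H3. }
repeat split; f_equal; field; exact HD.
Qed.

End Parametrized_surface.

Definition flat_surface (rho : R) (p : vec3) : Prop :=
  exists y z, -1 <= y <= 1 /\ 0 <= z <= rho /\ p = mkvec 0 y z.
Definition flat_param (y z : R) : vec3 := mkvec 0 y z.

(* Main.v *)
Require Import Defs.
From Stdlib Require Import Reals Lra.
From Coquelicot Require Import Coquelicot.
Open Scope R_scope.

(** Write [u] for the normal component of a velocity [v] of the flat surface and
    [k = PI / rho].  The second variation is [sigma] times

      the integral of |grad u|^2 over the rectangle
      - the integral over 0 < z < rho of u(1,z)^2 + u(-1,z)^2.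

    Indeed (div v)^2 - tr((grad v)^2) is twice a Jacobian determinant of the
    tangential components, hence a divergence, and its flux vanishes: the
    component along [y] is zero on the sides, and the component along [z] is zero
    on the wires together with its derivative along them.  The acceleration also
    contributes only through its flux, which the constraint on the sides turns
    into the negative boundary term.  This is [second_variation_flat], a
    consequence of [divergence_theorem].

    Stability is thus a trace inequality for functions that vanish on the wires,
    and the best constant in

      C * (integral of u^2 over both sides) <= integral of |grad u|^2

    is [k * tanh k].  That this constant is admissible ([trace_inequality])
    follows by separating the variables.  In the direction of [z], Wirtinger's
    inequality bounds the integral of u_z^2 below by [k ^ 2] times that of u^2
    ([energy_wirtinger]).  In the direction of [y], on each line,
    u_y^2 + k^2 u^2 is at least the derivative of k tanh(k y) u^2
    ([tanh_boundary_inequality]).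

    The constant is attained by the harmonic function cosh(k y) sin(k z), which
    turns both bounds into equalities.  Being harmonic, its energy is a boundary
    integral, and its second variation is a positive multiple of
    k sinh k - cosh k ([critical_mode_energy]); so stability forces
    1 <= k tanh k.  Completing this velocity by an admissible acceleration is
    explicit ([critical_mode_acceleration]). *)

(** * Calculus on rectangles *)

(** Carrying the partial derivatives as explicit functions lets sums and products
    deliver the integrands of the divergence theorem in closed form. *)
Definition is_C1 (g gy gz : R -> R -> R) : Prop := forall y z,
  is_derive (fun s => g s z) y (gy y z) /\
  is_derive (fun s => g y s) z (gz y z) /\
  continuity_2d_pt g y z /\
  continuity_2d_pt gy y z /\
  continuity_2d_pt gz y z.

Ltac split_C1 := split; [| split; [| split; [| split]]].

Definition partial_y (g : R -> R -> R) (y z : R) : R := Derive (fun s => g s z) y.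
Definition partial_z (g : R -> R -> R) (y z : R) : R := Derive (fun s => g y s) z.

Definition rect_int (a b c d : R) (g : R -> R -> R) : R :=
  RInt (fun z => RInt (fun y => g y z) a b) c d.

Lemma is_C1_const (c : R) :
  is_C1 (fun _ _ => c) (fun _ _ => 0) (fun _ _ => 0).
Proof.
intros y z; split_C1; try apply continuity_2d_pt_const.
- exact (is_derive_const c y).
- exact (is_derive_const c z).
Qed.

Lemma is_C1_plus (f fy fz g gy gz : R -> R -> R) :
  is_C1 f fy fz -> is_C1 g gy gz ->
  is_C1 (fun y z => f y z + g y z) (fun y z => fy y z + gy y z)
        (fun y z => fz y z + gz y z).
Proof.
intros Hf Hg y z.
destruct (Hf y z) as (f1 & f2 & f3 & f4 & f5).
destruct (Hg y z) as (g1 & g2 & g3 & g4 & g5).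
split_C1; try (apply continuity_2d_pt_plus; assumption).
- exact (is_derive_plus (fun s => f s z) (fun s => g s z) y _ _ f1 g1).
- exact (is_derive_plus (fun s => f y s) (fun s => g y s) z _ _ f2 g2).
Qed.

Lemma is_C1_mult (f fy fz g gy gz : R -> R -> R) :
  is_C1 f fy fz -> is_C1 g gy gz ->
  is_C1 (fun y z => f y z * g y z)
        (fun y z => fy y z * g y z + f y z * gy y z)
        (fun y z => fz y z * g y z + f y z * gz y z).
Proof.
intros Hf Hg y z.
destruct (Hf y z) as (f1 & f2 & f3 & f4 & f5).
destruct (Hg y z) as (g1 & g2 & g3 & g4 & g5).
split_C1;
  try (repeat apply continuity_2d_pt_plus; apply continuity_2d_pt_mult; assumption).
- exact (is_derive_mult (fun s => f s z) (fun s => g s z) y _ _ f1 g1 Rmult_comm).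
- exact (is_derive_mult (fun s => f y s) (fun s => g y s) z _ _ f2 g2 Rmult_comm).
Qed.

Lemma is_C1_of_ex_diff (g : R -> R -> R) :
  (forall y z, ex_diff_n g 1 y z) -> is_C1 g (partial_y g) (partial_z g).
Proof.
intros H y z; destruct (H y z) as (c & ey & ez & (cy & _) & (cz & _)).
split_C1; auto; apply Derive_correct; assumption.
Qed.

Lemma is_C1_of_C2 (g : R -> R -> R) :
  C2_scalar g -> is_C1 g (partial_y g) (partial_z g).
Proof.
intros H; apply is_C1_of_ex_diff; intros y z.
destruct (H y z) as (c & ey & ez & (cy & _) & (cz & _)).
simpl; tauto.
Qed.

Lemma is_C1_partial_y (g : R -> R -> R) :
  C2_scalar g ->
  is_C1 (partial_y g) (partial_y (partial_y g)) (partial_z (partial_y g)).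
Proof.
intros H; apply is_C1_of_ex_diff; intros y z.
destruct (H y z) as (_ & _ & _ & h & _); exact h.
Qed.

Lemma is_C1_partial_z (g : R -> R -> R) :
  C2_scalar g ->
  is_C1 (partial_z g) (partial_y (partial_z g)) (partial_z (partial_z g)).
Proof.
intros H; apply is_C1_of_ex_diff; intros y z.
destruct (H y z) as (_ & _ & _ & _ & h); exact h.
Qed.

Lemma partial_comm (g : R -> R -> R) (y z : R) :
  C2_scalar g -> partial_z (partial_y g) y z = partial_y (partial_z g) y z.
Proof.
intros H.
assert (Hy := is_C1_partial_y g H); assert (Hz := is_C1_partial_z g H).
assert (H0 := is_C1_of_C2 g H).
symmetry; apply (Schwarz g y z).
- exists (mkposreal 1 Rlt_0_1); intros u v _ _.
  destruct (H0 u v) as (a1 & a2 & _), (Hy u v) as (_ & b2 & _),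
    (Hz u v) as (c1 & _).
  repeat split; eexists; eassumption.
- apply (Hz y z).
- apply (Hy y z).
Qed.

Lemma continuity_2d_pt_sq (g : R -> R -> R) (y z : R) :
  continuity_2d_pt g y z -> continuity_2d_pt (fun y z => g y z ^ 2) y z.
Proof.
intros H; simpl.
repeat first [apply continuity_2d_pt_mult | exact H | apply continuity_2d_pt_const].
Qed.

Lemma continuous_slice_y (g : R -> R -> R) (y z : R) :
  continuity_2d_pt g y z -> continuous (fun s => g s z) y.
Proof.
intros H; apply continuity_pt_filterlim, continuity_pt_locally; intros eps.
destruct (H eps) as [d Hd]; exists d; intros s Hs.
apply Hd; [exact Hs | rewrite Rminus_diag, Rabs_R0; apply cond_pos].
Qed.

Lemma continuous_slice_z (g : R -> R -> R) (y z : R) :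
  continuity_2d_pt g y z -> continuous (fun s => g y s) z.
Proof.
intros H; apply continuity_pt_filterlim, continuity_pt_locally; intros eps.
destruct (H eps) as [d Hd]; exists d; intros s Hs.
apply Hd; [rewrite Rminus_diag, Rabs_R0; apply cond_pos | exact Hs].
Qed.

Lemma continuity_2d_pt_swap (g : R -> R -> R) (y z : R) :
  continuity_2d_pt g y z -> continuity_2d_pt (fun u v => g v u) z y.
Proof.
intros H eps; destruct (H eps) as [d Hd]; exists d; intros u v Hu Hv.
apply Hd; assumption.
Qed.

Lemma ex_RInt_slice_y (g : R -> R -> R) (a b z : R) :
  (forall y z, continuity_2d_pt g y z) -> ex_RInt (fun y => g y z) a b.
Proof.
intros H; apply (ex_RInt_continuous (fun y => g y z)).
intros y _; apply continuous_slice_y, H.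
Qed.

(** Uniform continuity of the integrand on [a, b] x [z - 1, z + 1] makes the
    integrals over [a, b] at [z] and at a nearby point differ by little. *)
Lemma continuous_RInt_param (g : R -> R -> R) (a b z : R) :
  a <= b -> (forall y z, continuity_2d_pt g y z) ->
  continuous (fun s => RInt (fun y => g y s) a b) z.
Proof.
intros hab H.
apply continuity_pt_filterlim, continuity_pt_locally; intros eps.
assert (he : 0 < eps / (b - a + 1)).
{ apply Rdiv_lt_0_compat; [apply cond_pos | lra]. }
destruct (uniform_continuity_2d g a b (z - 1) (z + 1)
            (fun y s _ _ => H y s) (mkposreal _ he)) as [d Hd].
simpl in Hd.
assert (hm : 0 < Rmin d 1) by (apply Rmin_pos; [apply cond_pos | lra]).
exists (mkposreal _ hm); intros s Hs.
change (Rabs (s - z) < Rmin d 1) in Hs.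
assert (hs1 : Rabs (s - z) < d) by (eapply Rlt_le_trans; [exact Hs | apply Rmin_l]).
assert (hs2 : Rabs (s - z) < 1) by (eapply Rlt_le_trans; [exact Hs | apply Rmin_r]).
assert (hs3 : z - 1 <= s <= z + 1) by (apply Rabs_def2 in hs2; lra).
rewrite <- (RInt_minus (fun y => g y s) (fun y => g y z))
  by (apply ex_RInt_slice_y, H).
apply Rle_lt_trans with ((b - a) * (eps / (b - a + 1))).
- apply (abs_RInt_le_const (fun y => minus (g y s) (g y z)) a b _ hab).
  + apply (ex_RInt_minus (fun y => g y s) (fun y => g y z));
      apply ex_RInt_slice_y, H.
  + intros y hy; apply Rlt_le.
    apply (Hd y z y s); try assumption; try lra.
    rewrite Rminus_diag, Rabs_R0; apply cond_pos.
- assert (e : eps = (b - a + 1) * (eps / (b - a + 1)) :> R) by (field; lra).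
  rewrite e at 2; lra.
Qed.

Lemma ex_rect_int (g : R -> R -> R) (a b c d : R) :
  a <= b -> (forall y z, continuity_2d_pt g y z) ->
  ex_RInt (fun z => RInt (fun y => g y z) a b) c d.
Proof.
intros hab H; apply (ex_RInt_continuous (fun z => RInt (fun y => g y z) a b)).
intros z _; apply continuous_RInt_param; assumption.
Qed.

Lemma rect_int_ext (f g : R -> R -> R) (a b c d : R) :
  (forall y z, f y z = g y z) -> rect_int a b c d f = rect_int a b c d g.
Proof.
intros H; apply RInt_ext; intros z _; apply RInt_ext; intros y _; apply H.
Qed.

Lemma rect_int_plus (f g : R -> R -> R) (a b c d : R) :
  a <= b ->
  (forall y z, continuity_2d_pt f y z) -> (forall y z, continuity_2d_pt g y z) ->
  rect_int a b c d (fun y z => f y z + g y z) =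
  rect_int a b c d f + rect_int a b c d g.
Proof.
intros hab Hf Hg; unfold rect_int.
rewrite <- (RInt_plus (fun z => RInt (fun y => f y z) a b)
             (fun z => RInt (fun y => g y z) a b)) by (apply ex_rect_int; assumption).
apply RInt_ext; intros z _.
apply (RInt_plus (fun y => f y z) (fun y => g y z)); apply ex_RInt_slice_y; assumption.
Qed.

Lemma rect_int_scal (k : R) (g : R -> R -> R) (a b c d : R) :
  a <= b -> (forall y z, continuity_2d_pt g y z) ->
  rect_int a b c d (fun y z => k * g y z) = k * rect_int a b c d g.
Proof.
intros hab Hg; unfold rect_int.
transitivity (RInt (fun z => k * RInt (fun y => g y z) a b) c d).
2: { apply (RInt_scal (fun z => RInt (fun y => g y z) a b));
     apply ex_rect_int; assumption. }
apply RInt_ext; intros z _.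
apply (RInt_scal (fun y => g y z)); apply ex_RInt_slice_y; assumption.
Qed.

Lemma is_derive_RInt_slice (q qy qz : R -> R -> R) (a b z : R) :
  is_C1 q qy qz ->
  is_derive (fun s => RInt (fun y => q y s) a b) z (RInt (fun y => qz y z) a b).
Proof.
intros H.
assert (E : forall y s, Derive (fun t => q y t) s = qz y s).
{ intros y s; apply is_derive_unique, H. }
rewrite (RInt_ext (fun y => qz y z) (fun y => Derive (fun t => q y t) z))
  by (intros; symmetry; apply E).
apply (is_derive_RInt_param (fun s y => q y s) a b z).
- apply filter_forall; intros s y _; exists (qz y s); apply H.
- intros y _; apply (continuity_2d_pt_ext (fun u v => qz v u)).
  + intros u v; symmetry; apply E.
  + apply (continuity_2d_pt_swap qz), H.
- apply filter_forall; intros s; apply ex_RInt_slice_y; intros; apply H.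
Qed.

(* Integration lemmas state equations in a carrier that is only convertible to
   the real numbers. *)
Ltac ring_R := match goal with |- @eq _ ?a ?b => change (@eq R a b); ring end.

(** Each half is the fundamental theorem of calculus in its own variable.  For the
    second half the outer variable is differentiated under the inner integral,
    so the order of integration is never exchanged. *)
Lemma divergence_theorem (p py pz q qy qz : R -> R -> R) (a b c d : R) :
  a <= b -> is_C1 p py pz -> is_C1 q qy qz ->
  rect_int a b c d (fun y z => py y z + qz y z) =
  RInt (fun z => p b z - p a z) c d + RInt (fun y => q y d - q y c) a b.
Proof.
intros hab Hp Hq.
rewrite rect_int_plus by (assumption || (intros; apply Hp || apply Hq)).
f_equal.
- apply RInt_ext; intros z _; apply is_RInt_unique.
  apply (is_RInt_derive (fun y => p y z)); intros y _.
  + apply Hp.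
  + apply (continuous_slice_y py), Hp.
- unfold rect_int; apply is_RInt_unique.
  replace (RInt (fun y => q y d - q y c) a b)
    with (minus (RInt (fun y => q y d) a b) (RInt (fun y => q y c) a b)).
  + apply (is_RInt_derive (fun z => RInt (fun y => q y z) a b)); intros z _.
    * apply (is_derive_RInt_slice q qy qz), Hq.
    * apply continuous_RInt_param; [exact hab | intros; apply Hq].
  + symmetry; apply (RInt_minus (fun y => q y d) (fun y => q y c));
      apply ex_RInt_slice_y; intros; apply Hq.
Qed.

(** * One-dimensional inequalities *)

Lemma cosh_gt_0 (x : R) : 0 < cosh x.
Proof. unfold cosh; assert (h1 := exp_pos x); assert (h2 := exp_pos (- x)); lra. Qed.

Lemma cosh_even (x : R) : cosh (- x) = cosh x.
Proof. unfold cosh; rewrite Ropp_involutive; lra. Qed.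

Lemma sinh_odd (x : R) : sinh (- x) = - sinh x.
Proof. unfold sinh; rewrite Ropp_involutive; lra. Qed.

Lemma tanh_odd (x : R) : tanh (- x) = - tanh x.
Proof.
unfold tanh; rewrite sinh_odd, cosh_even.
assert (h := cosh_gt_0 x); field; lra.
Qed.

Lemma is_derive_tanh (k y : R) :
  is_derive (fun s => tanh (k * s)) y (k * (1 - tanh (k * y) ^ 2)).
Proof.
assert (h := cosh_gt_0 (k * y)).
unfold tanh; auto_derive; [lra | field; lra].
Qed.

Lemma continuous_Rplus (f g : R -> R) (x : R) :
  continuous f x -> continuous g x -> continuous (fun y => f y + g y) x.
Proof. exact (continuous_plus f g x). Qed.

Lemma continuous_Rmult (f g : R -> R) (x : R) :
  continuous f x -> continuous g x -> continuous (fun y => f y * g y) x.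
Proof. exact (continuous_mult f g x). Qed.

Lemma continuous_Rsq (f : R -> R) (x : R) :
  continuous f x -> continuous (fun y => f y ^ 2) x.
Proof.
intros H; simpl.
apply continuous_Rmult; [exact H |].
apply continuous_Rmult; [exact H | apply continuous_const].
Qed.

Lemma continuous_of_is_derive (f : R -> R) (x l : R) :
  is_derive f x l -> continuous f x.
Proof. intros H; apply (ex_derive_continuous f); exists l; exact H. Qed.

Ltac continuity_R := lazymatch goal with
  | |- continuous (fun y => @?f y + @?g y) _ =>
      apply (continuous_Rplus f g); continuity_R
  | |- continuous (fun y => @?f y * @?g y) _ =>
      apply (continuous_Rmult f g); continuity_R
  | |- continuous (fun y => @?f y ^ 2) _ => apply (continuous_Rsq f); continuity_R
  | |- _ => cbv beta; first [assumption | solve [auto] | apply continuous_const]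
  end.

Lemma continuous_of_derive_everywhere (f : R -> R) :
  (forall x, ex_derive f x) -> forall x, continuous f x.
Proof. intros H x; apply (ex_derive_continuous f), H. Qed.

Lemma Derive_zero_inside (g : R -> R) (a b y : R) :
  (forall s, a <= s <= b -> g s = 0) -> a < y < b -> Derive g y = 0.
Proof.
intros H hy; rewrite (Derive_ext_loc g (fun _ => 0)); [apply Derive_const |].
apply (locally_interval _ y a b); simpl; try lra; intros s; simpl; intros; apply H; lra.
Qed.

Lemma increment_le_RInt (F F' G : R -> R) (a b : R) :
  a <= b ->
  (forall x, a <= x <= b -> is_derive F x (F' x)) ->
  (forall x, a <= x <= b -> continuous F' x) ->
  (forall x, a <= x <= b -> continuous G x) ->
  (forall x, a <= x <= b -> F' x <= G x) ->
  F b - F a <= RInt G a b.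
Proof.
intros hab DF CF' CG H.
assert (E : is_RInt F' a b (F b - F a)).
{ apply (is_RInt_derive F F'); rewrite Rmin_left, Rmax_right by lra; assumption. }
rewrite <- (is_RInt_unique _ _ _ _ E).
apply RInt_le; [lra | eexists; exact E | | intros; apply H; lra].
apply (ex_RInt_continuous G); rewrite Rmin_left, Rmax_right by lra; assumption.
Qed.

(** The weight w(y) = k tanh(k y) solves the Riccati equation w' + w^2 = k^2.
    Hence the derivative of w f^2 is k^2 f^2 + f'^2 - (f' - w f)^2, and
    integrating it produces the left-hand side because tanh is odd. *)
Lemma tanh_boundary_inequality (f f' : R -> R) (k b : R) :
  0 <= b -> (forall y, is_derive f y (f' y)) -> (forall y, continuous f' y) ->
  k * tanh (k * b) * (f b ^ 2 + f (- b) ^ 2) <=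
  RInt (fun y => f' y ^ 2 + k ^ 2 * f y ^ 2) (- b) b.
Proof.
intros hb Df Cf'.
assert (Cf : forall y, continuous f y).
{ intros y; apply (continuous_of_is_derive f y (f' y)), Df. }
assert (Ct : forall y, continuous (fun s => tanh (k * s)) y).
{ intros y; eapply continuous_of_is_derive, is_derive_tanh. }
set (F := fun y => k * (tanh (k * y) * f y ^ 2)).
set (F' := fun y => k * ((k * (1 + - 1 * tanh (k * y) ^ 2)) * f y ^ 2
                         + tanh (k * y) * (2 * (f y * f' y)))).
replace (k * tanh (k * b) * (f b ^ 2 + f (- b) ^ 2)) with (F b - F (- b)).
2: { unfold F; rewrite Ropp_mult_distr_r_reverse, tanh_odd; ring. }
apply (increment_le_RInt F F'); [lra | | | |]; intros y _.
- unfold F, F'.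
  assert (D1 := Df y); assert (D2 := is_derive_tanh k y).
  set (t := fun s => tanh (k * s)) in D2.
  change (is_derive (fun s => k * (t s * f s ^ 2)) y
            (k * ((k * (1 + - 1 * t y ^ 2)) * f y ^ 2 + t y * (2 * (f y * f' y))))).
  change (is_derive t y (k * (1 - t y ^ 2))) in D2.
  clearbody t.
  auto_derive.
  + repeat split; eexists; eassumption.
  + rewrite (is_derive_unique (fun s : R => f s) y _ D1).
    rewrite (is_derive_unique (fun s : R => t s) y _ D2). ring.
- unfold F'.
  continuity_R.
- continuity_R.
- unfold F'; generalize (tanh (k * y)) (f y) (f' y); intros t u v.
  assert (h := pow2_ge_0 (v - k * t * u)); nra.
Qed.

(** Passage to the limit kappa -> k, needed because the weight in
    [energy_wirtinger] blows up at the end points for kappa = k. *)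
Lemma scaled_limit_le (A B k : R) :
  0 < k -> 0 <= B -> (forall kappa, 0 < kappa < k -> kappa ^ 2 * B <= A) ->
  k ^ 2 * B <= A.
Proof.
intros hk hB H.
destruct (Rle_lt_dec (k ^ 2 * B) A) as [h | h]; [exact h | exfalso].
set (X := k ^ 2 * B) in *.
assert (h0 : forall t, 0 < t < 1 -> (1 - 2 * t) * X <= A).
{ intros t ht.
  assert (h1 : 0 < k * (1 - t) < k) by nra.
  assert (h2 := H _ h1).
  assert (hX : 0 <= X) by (unfold X; apply Rmult_le_pos; [apply pow2_ge_0 | exact hB]).
  replace ((k * (1 - t)) ^ 2 * B) with ((1 - t) ^ 2 * X) in h2 by (unfold X; ring).
  nra. }
assert (hA : 0 <= A) by (assert (h1 := h0 (1 / 2) ltac:(lra)); lra).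
assert (h1 := h0 ((X - A) / (4 * X))).
assert (h2 : 0 < (X - A) / (4 * X) < 1).
{ split; [apply Rdiv_lt_0_compat; lra | apply (Rmult_lt_reg_r (4 * X)); [lra |]].
  field_simplify; lra. }
specialize (h1 h2).
replace ((1 - 2 * ((X - A) / (4 * X))) * X) with ((X + A) / 2) in h1 by (field; lra).
lra.
Qed.

(** Wirtinger's inequality for a function with values in a Hilbert space: [I] is
    its squared norm, [I'] the derivative of that, [J] the squared norm of its
    derivative.  The last hypothesis says that [J - h I' + h^2 I], the squared
    norm of the derivative minus [h] times the function, is nonnegative.  In this
    form an integral over the other
    variable can play the role of the norm, so that Wirtinger's inequality is
    integrated over the rectangle without Fubini.

    For 0 < kappa < PI / (d - c) the weight h(z) = - kappa tan(kappa (z - m)),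
    with m the midpoint, is smooth on [c, d] and satisfies h' = - kappa^2 - h^2.
    Thus (h I)' <= J - kappa^2 I, and the left-hand side integrates to zero. *)
Lemma energy_wirtinger (I I' J : R -> R) (c d : R) :
  c < d -> I c = 0 -> I d = 0 ->
  (forall z, is_derive I z (I' z)) ->
  (forall z, continuous I' z) -> (forall z, continuous J z) ->
  (forall z, 0 <= I z) ->
  (forall h z, h * I' z - h ^ 2 * I z <= J z) ->
  (PI / (d - c)) ^ 2 * RInt I c d <= RInt J c d.
Proof.
intros hcd Ic Id DI CI' CJ I_ge H.
assert (CI : forall z, continuous I z).
{ intros z; apply (continuous_of_is_derive I z (I' z)), DI. }
assert (EI : ex_RInt I c d) by (apply (ex_RInt_continuous I); intros; apply CI).
assert (EJ : ex_RInt J c d) by (apply (ex_RInt_continuous J); intros; apply CJ).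
assert (hPI := PI_RGT_0).
apply scaled_limit_le.
- apply Rdiv_lt_0_compat; lra.
- apply RInt_ge_0; [lra | exact EI | auto].
- intros kappa [hk1 hk2].
  set (x := fun z => kappa * (z - (c + d) / 2)).
  set (h := fun z => - kappa * tan (x z)).
  assert (hcos : forall z, c <= z <= d -> 0 < cos (x z)).
  { intros z hz; assert (hk3 : kappa * (d - c) < PI).
    { replace PI with (PI / (d - c) * (d - c)) by (field; lra).
      apply Rmult_lt_compat_r; lra. }
    apply cos_gt_0; unfold x; nra. }
  assert (Dh : forall z, c <= z <= d -> is_derive h z (- kappa ^ 2 + - 1 * h z ^ 2)).
  { intros z hz; specialize (hcos z hz).
    assert (Dx : is_derive x z kappa) by (unfold x; auto_derive; [exact Logic.I | ring]).
    assert (D := is_derive_comp tan x z _ _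
                   (is_derive_tan _ (Rgt_not_eq _ _ hcos)) Dx).
    replace (- kappa ^ 2 + - 1 * h z ^ 2)
      with (- kappa * (kappa * (tan (x z) ^ 2 + 1))) by (unfold h; ring).
    exact (is_derive_scal (fun z => tan (x z)) z (- kappa) _ D). }
  assert (Ch : forall z, c <= z <= d -> continuous h z).
  { intros z hz; eapply continuous_of_is_derive, Dh, hz. }
  assert (Hinc := increment_le_RInt (fun z => h z * I z)
            (fun z => (- kappa ^ 2 + - 1 * h z ^ 2) * I z + h z * I' z)
            (fun z => J z + - kappa ^ 2 * I z) c d).
  assert (E : RInt (fun z => J z + - kappa ^ 2 * I z) c d
              = RInt J c d + - kappa ^ 2 * RInt I c d).
  { exact (is_RInt_unique _ _ _ _
      (is_RInt_plus J (fun z => - kappa ^ 2 * I z) c d _ _ (RInt_correct J c d EJ)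
        (is_RInt_scal I c d (- kappa ^ 2) _ (RInt_correct I c d EI)))). }
  rewrite E, Ic, Id in Hinc.
  enough (0 <= RInt J c d + - kappa ^ 2 * RInt I c d) by lra.
  replace 0 with (h d * 0 - h c * 0) by ring.
  apply Hinc; [lra | | | |]; intros z hz.
  + exact (is_derive_mult h I z _ _ (Dh z hz) (DI z) Rmult_comm).
  + assert (C := Ch z hz).
    continuity_R.
  + continuity_R.
  + assert (h1 := H (h z) z); nra.
Qed.

(** * Products of functions of one variable *)

Lemma is_C1_tensor (p p' q q' : R -> R) :
  (forall y, is_derive p y (p' y)) -> (forall y, continuous p' y) ->
  (forall z, is_derive q z (q' z)) -> (forall z, continuous q' z) ->
  is_C1 (fun y z => p y * q z) (fun y z => p' y * q z) (fun y z => p y * q' z).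
Proof.
intros Dp Cp' Dq Cq'.
assert (Cp : forall y, continuous p y) by (intros; eapply continuous_of_is_derive, Dp).
assert (Cq : forall z, continuous q z) by (intros; eapply continuous_of_is_derive, Dq).
assert (C : forall f g : R -> R, (forall y, continuous f y) -> (forall z, continuous g z) ->
          forall y z, continuity_2d_pt (fun y z => f y * g z) y z).
{ intros f g Cf Cg y z; apply continuity_2d_pt_mult.
  - apply (continuity_1d_2d_pt_comp f (fun y _ => y));
      [apply continuity_pt_filterlim, Cf | apply continuity_2d_pt_id1].
  - apply (continuity_1d_2d_pt_comp g (fun _ z => z));
      [apply continuity_pt_filterlim, Cg | apply continuity_2d_pt_id2]. }
intros y z; split_C1; auto.
- apply (is_derive_ext (fun s => q z * p s)); [intros; apply Rmult_comm |].
  rewrite Rmult_comm; exact (is_derive_scal p y (q z) _ (Dp y)).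
- exact (is_derive_scal q z (p y) _ (Dq z)).
Qed.

Lemma ex_diff_1_of_is_C1 (g gy gz : R -> R -> R) (y z : R) :
  is_C1 g gy gz -> ex_diff_n g 1 y z.
Proof.
intros H; destruct (H y z) as (d1 & d2 & c0 & c1 & c2).
split; [exact c0 |].
split; [eexists; exact d1 |].
split; [eexists; exact d2 |].
split; (split; [| exact I]).
- apply (continuity_2d_pt_ext gy); [| exact c1].
  intros u v; symmetry; apply is_derive_unique, (H u v).
- apply (continuity_2d_pt_ext gz); [| exact c2].
  intros u v; symmetry; apply is_derive_unique, (H u v).
Qed.

Lemma C2_of_is_C1 (g gy gz gyy gyz gzy gzz : R -> R -> R) :
  is_C1 g gy gz -> is_C1 gy gyy gyz -> is_C1 gz gzy gzz -> C2_scalar g.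
Proof.
intros H Hy Hz y z; destruct (H y z) as (d1 & d2 & c0 & _).
split; [exact c0 |].
split; [eexists; exact d1 |].
split; [eexists; exact d2 |].
split.
- apply (ex_diff_n_ext_loc gy); [| exact (ex_diff_1_of_is_C1 _ _ _ y z Hy)].
  exists (mkposreal 1 Rlt_0_1); intros u v _ _; symmetry; apply is_derive_unique, (H u v).
- apply (ex_diff_n_ext_loc gz); [| exact (ex_diff_1_of_is_C1 _ _ _ y z Hz)].
  exists (mkposreal 1 Rlt_0_1); intros u v _ _; symmetry; apply is_derive_unique, (H u v).
Qed.

Lemma C2_tensor (p p' p'' q q' q'' : R -> R) :
  (forall y, is_derive p y (p' y)) -> (forall y, is_derive p' y (p'' y)) ->
  (forall y, continuous p'' y) ->
  (forall z, is_derive q z (q' z)) -> (forall z, is_derive q' z (q'' z)) ->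
  (forall z, continuous q'' z) ->
  C2_scalar (fun y z => p y * q z).
Proof.
intros Dp Dp' Cp'' Dq Dq' Cq''.
assert (Cp' : forall y, continuous p' y) by (intros; eapply continuous_of_is_derive, Dp').
assert (Cq' : forall z, continuous q' z) by (intros; eapply continuous_of_is_derive, Dq').
eapply C2_of_is_C1; eapply is_C1_tensor; eassumption.
Qed.

Lemma C2_scalar_ext (f g : R -> R -> R) :
  (forall y z, f y z = g y z) -> C2_scalar f -> C2_scalar g.
Proof.
intros E H y z; apply (ex_diff_n_ext_loc f); [| apply H].
exists (mkposreal 1 Rlt_0_1); intros u v _ _; apply E.
Qed.

Lemma C2_const (c : R) : C2_scalar (fun _ _ => c).
Proof. eapply C2_of_is_C1; apply is_C1_const. Qed.

(** * The trace inequality *)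

Lemma trace_inequality (u uy uz : R -> R -> R) (rho : R) :
  0 < rho -> is_C1 u uy uz ->
  (forall y, -1 <= y <= 1 -> u y 0 = 0 /\ u y rho = 0) ->
  PI / rho * tanh (PI / rho) * RInt (fun z => u 1 z ^ 2 + u (-1) z ^ 2) 0 rho <=
  rect_int (-1) 1 0 rho (fun y z => uy y z ^ 2 + uz y z ^ 2).
Proof.
intros hrho Hu H0.
set (k := PI / rho).
assert (C2sq : forall f : R -> R -> R, (forall y z, continuity_2d_pt f y z) ->
          forall y z, continuity_2d_pt (fun y z => f y z ^ 2) y z).
{ intros f Hf y z; apply continuity_2d_pt_sq, Hf. }
assert (Cu : forall y z, continuity_2d_pt u y z) by (intros; apply Hu).
assert (Cuy : forall y z, continuity_2d_pt uy y z) by (intros; apply Hu).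
assert (Cuz : forall y z, continuity_2d_pt uz y z) by (intros; apply Hu).
assert (Cku : forall y z, continuity_2d_pt (fun y z => k ^ 2 * u y z ^ 2) y z).
{ intros; apply continuity_2d_pt_mult; [apply continuity_2d_pt_const | now apply C2sq]. }
(* Wirtinger's inequality in z, for u(., z) as an element of L^2(-1, 1). *)
assert (W : k ^ 2 * rect_int (-1) 1 0 rho (fun y z => u y z ^ 2)
            <= rect_int (-1) 1 0 rho (fun y z => uz y z ^ 2)).
{ assert (Hsq : is_C1 (fun y z => u y z ^ 2) (fun y z => 2 * (u y z * uy y z))
                  (fun y z => 2 * (u y z * uz y z))).
  { intros y z; destruct (is_C1_mult _ _ _ _ _ _ Hu Hu y z) as (d1 & d2 & c0 & c1 & c2).
    split_C1.
    - apply is_derive_ext with (fun s => u s z * u s z); [intros; simpl; ring |].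
      replace (2 * (u y z * uy y z)) with (uy y z * u y z + u y z * uy y z) by ring.
      exact d1.
    - apply is_derive_ext with (fun s => u y s * u y s); [intros; simpl; ring |].
      replace (2 * (u y z * uz y z)) with (uz y z * u y z + u y z * uz y z) by ring.
      exact d2.
    - now apply C2sq.
    - repeat apply continuity_2d_pt_mult; auto; apply continuity_2d_pt_const.
    - repeat apply continuity_2d_pt_mult; auto; apply continuity_2d_pt_const. }
  unfold rect_int, k; replace (PI / rho) with (PI / (rho - 0)) by (f_equal; ring).
  apply (energy_wirtinger
    (fun z => RInt (fun y => u y z ^ 2) (-1) 1)
    (fun z => RInt (fun y => 2 * (u y z * uz y z)) (-1) 1)
    (fun z => RInt (fun y => uz y z ^ 2) (-1) 1)); [exact hrho | | | | | | |].
  - rewrite (RInt_ext _ (fun _ => 0)), RInt_const; [exact (Rmult_0_r _) |].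
    intros y hy; rewrite Rmin_left, Rmax_right in hy by lra.
    rewrite (proj1 (H0 y ltac:(lra))); simpl; ring.
  - rewrite (RInt_ext _ (fun _ => 0)), RInt_const; [exact (Rmult_0_r _) |].
    intros y hy; rewrite Rmin_left, Rmax_right in hy by lra.
    rewrite (proj2 (H0 y ltac:(lra))); simpl; ring.
  - intros z; exact (is_derive_RInt_slice _ _ _ (-1) 1 z Hsq).
  - intros z; apply (continuous_RInt_param (fun y z => 2 * (u y z * uz y z)));
      [lra | intros; apply Hsq].
  - intros z; apply (continuous_RInt_param (fun y z => uz y z ^ 2)); [lra | now apply C2sq].
  - intros z; apply RInt_ge_0; [lra | | intros; apply pow2_ge_0].
    apply (ex_RInt_slice_y (fun y z => u y z ^ 2)); now apply C2sq.
  - intros h z.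
    assert (e1 : ex_RInt (fun y => 2 * (u y z * uz y z)) (-1) 1).
    { apply (ex_RInt_slice_y (fun y z => 2 * (u y z * uz y z))); intros; apply Hsq. }
    assert (e2 : ex_RInt (fun y => u y z ^ 2) (-1) 1).
    { apply (ex_RInt_slice_y (fun y z => u y z ^ 2)); now apply C2sq. }
    assert (e3 := is_RInt_minus _ _ _ _ _ _
      (is_RInt_scal _ _ _ h _ (RInt_correct _ _ _ e1))
      (is_RInt_scal _ _ _ (h ^ 2) _ (RInt_correct _ _ _ e2))).
    eapply Rle_trans; [right; symmetry; exact (is_RInt_unique _ _ _ _ e3) |].
    apply RInt_le; [lra | eexists; exact e3 | |].
    + apply (ex_RInt_slice_y (fun y z => uz y z ^ 2)); now apply C2sq.
    + intros y _.
      change (h * (2 * (u y z * uz y z)) - h ^ 2 * u y z ^ 2 <= uz y z ^ 2).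
      assert (h1 := pow2_ge_0 (uz y z - h * u y z)); nra. }
(* The term k^2 u^2 lent here to the y-direction is repaid by [W]. *)
assert (T : k * tanh k * RInt (fun z => u 1 z ^ 2 + u (-1) z ^ 2) 0 rho
            <= rect_int (-1) 1 0 rho (fun y z => uy y z ^ 2 + k ^ 2 * u y z ^ 2)).
{ assert (e : ex_RInt (fun z => u 1 z ^ 2 + u (-1) z ^ 2) 0 rho).
  { apply (ex_RInt_continuous (fun z => u 1 z ^ 2 + u (-1) z ^ 2)); intros z _.
    apply continuous_Rplus; apply continuous_Rsq; apply continuous_slice_z; apply Cu. }
  assert (es := is_RInt_scal _ _ _ (k * tanh k) _ (RInt_correct _ _ _ e)).
  eapply Rle_trans; [right; symmetry; exact (is_RInt_unique _ _ _ _ es) |].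
  apply RInt_le; [lra | eexists; exact es | |].
  - apply (ex_rect_int (fun y z => uy y z ^ 2 + k ^ 2 * u y z ^ 2)); [lra |].
    intros; apply continuity_2d_pt_plus; [now apply C2sq | apply Cku].
  - intros z _.
    assert (h := tanh_boundary_inequality (fun y => u y z) (fun y => uy y z) k 1
      ltac:(lra) (fun y => proj1 (Hu y z))
      (fun y => continuous_slice_y uy y z (Cuy y z))).
    rewrite Rmult_1_r in h; exact h. }
rewrite (rect_int_plus (fun y z => uy y z ^ 2) (fun y z => k ^ 2 * u y z ^ 2)) in T
  by (lra || now apply C2sq || assumption).
rewrite (rect_int_scal (k ^ 2) (fun y z => u y z ^ 2)) in T
  by (lra || now apply C2sq).
rewrite (rect_int_plus (fun y z => uy y z ^ 2) (fun y z => uz y z ^ 2))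
  by (lra || now apply C2sq).
lra.
Qed.

(** * The flat surface *)

Lemma vdot_self_ge_0 (p : vec3) : 0 <= vdot p p.
Proof.
unfold vdot; assert (sq := Rle_0_sqr); unfold Rsqr in sq.
repeat apply Rplus_le_le_0_compat; apply sq.
Qed.

Lemma normal_vector_flat (y z : R) : normal_vector flat_param y z = e_x.
Proof.
assert (E1 : dy flat_param y z = e_y).
{ unfold dy, flat_param, e_y; simpl.
  rewrite !Derive_const, Derive_id; reflexivity. }
assert (E2 : dz flat_param y z = e_z).
{ unfold dz, flat_param, e_z; simpl.
  rewrite !Derive_const, Derive_id; reflexivity. }
unfold normal_vector; rewrite E1, E2; unfold vcross, e_x; simpl; f_equal; ring.
Qed.

Lemma area_density_flat (y z : R) : area_density flat_param y z = 1.
Proof.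
unfold area_density, vnorm; rewrite normal_vector_flat.
unfold vdot; simpl; replace (1 * 1 + 0 * 0 + 0 * 0) with 1 by ring; apply sqrt_1.
Qed.

Lemma unit_normal_flat (y z : R) : unit_normal flat_param y z = e_x.
Proof.
unfold unit_normal; rewrite area_density_flat, normal_vector_flat.
unfold vscale, e_x; simpl; f_equal; field.
Qed.

Lemma surface_grad_flat (v : R -> R -> vec3) (y z : R) (w : vec3) :
  surface_grad flat_param v y z w =
  vadd (vscale (vy w) (dy v y z)) (vscale (vz w) (dz v y z)).
Proof.
assert (E1 : dual_y flat_param y z = e_y).
{ unfold dual_y; rewrite normal_vector_flat; unfold dz, flat_param; simpl.
  rewrite !Derive_const, Derive_id.
  unfold vscale, vcross, vdot, e_y; simpl; f_equal; field. }
assert (E2 : dual_z flat_param y z = e_z).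
{ unfold dual_z; rewrite normal_vector_flat; unfold dy, flat_param; simpl.
  rewrite !Derive_const, Derive_id.
  unfold vscale, vcross, vdot, e_z; simpl; f_equal; field. }
unfold surface_grad; rewrite E1, E2; unfold vdot; simpl.
f_equal; f_equal; ring.
Qed.

Lemma surface_integral_flat (rho : R) (g : R -> R -> R) :
  surface_integral flat_param rho g = rect_int (-1) 1 0 rho g.
Proof.
apply RInt_ext; intros z _; apply RInt_ext; intros y _.
rewrite area_density_flat; apply Rmult_1_r.
Qed.

Lemma surface_div_flat (v : R -> R -> vec3) (y z : R) :
  surface_div flat_param v y z =
  partial_y (fun y z => vy (v y z)) y z + partial_z (fun y z => vz (v y z)) y z.
Proof.
unfold surface_div, trace; rewrite !surface_grad_flat.
unfold partial_y, partial_z, vadd, vscale, vdot, dy, dz; simpl; ring.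
Qed.

(** The last term is twice a Jacobian determinant of the tangential components of
    the velocity: it is what remains of (div v)^2 - tr((grad v)^2). *)
Lemma second_variation_density_flat (v : R -> R -> vec3) (y z : R) :
  let L := surface_grad flat_param v y z in
  vnorm (transpose L (unit_normal flat_param y z)) ^ 2
  + surface_div flat_param v y z ^ 2 - trace (fun w => L (L w)) =
  partial_y (fun y z => vx (v y z)) y z ^ 2
  + partial_z (fun y z => vx (v y z)) y z ^ 2
  + 2 * (partial_y (fun y z => vy (v y z)) y z * partial_z (fun y z => vz (v y z)) y z
         - partial_z (fun y z => vy (v y z)) y z * partial_y (fun y z => vz (v y z)) y z).
Proof.
cbv zeta; rewrite unit_normal_flat, surface_div_flat.
unfold vnorm; rewrite pow2_sqrt by apply vdot_self_ge_0.
unfold trace, transpose; rewrite !surface_grad_flat.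
unfold partial_y, partial_z, vadd, vscale, vdot, dy, dz; simpl; ring.
Qed.

Lemma wires_flat (rho y z : R) :
  wires rho (flat_param y z) <-> -1 <= y <= 1 /\ (z = 0 \/ z = rho).
Proof.
unfold wires, wire1, wire2, flat_param; split.
- intros [[s [hs e]] | [s [hs e]]]; injection e; intros; subst; split; auto;
    apply Rabs_le_between; exact hs.
- intros [hy [-> | ->]]; [left | right]; exists y; split; auto; apply Rabs_le; lra.
Qed.

Lemma tangential_flat (rho : R) (v : R -> R -> vec3) :
  0 < rho -> tangential_on_wires flat_param rho v ->
  forall y z, -1 <= y <= 1 -> z = 0 \/ z = rho -> vx (v y z) = 0 /\ vz (v y z) = 0.
Proof.
intros hrho H y z hy hz.
assert (E : v y z = vscale (vdot (v y z) wire_tangent) wire_tangent).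
{ apply H.
  - split; [split; [exact hy | destruct hz; subst; lra] | tauto].
  - apply wires_flat; tauto. }
rewrite E; unfold vscale, wire_tangent, e_y; simpl; split; ring.
Qed.

Lemma velocity_side_flat (rho : R) (v : R -> R -> vec3) :
  admissible_velocity flat_param rho v ->
  forall y z, y = -1 \/ y = 1 -> 0 < z < rho -> vy (v y z) = 0.
Proof.
intros (_ & _ & H) y z hy hz.
assert (E : vdot (v y z) (radial (flat_param y z)) = 0).
{ apply H.
  - split; [split; [destruct hy; subst; lra | lra] | tauto].
  - rewrite wires_flat; lra. }
unfold vdot, radial, flat_param in E; simpl in E; destruct hy; subst; lra.
Qed.

(** This is how the curvature of the cylinder enters: the second-order condition
    for staying on it pulls the sides inwards by the square of the normal
    velocity, the tangential velocity along [y] being zero there. *)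
Lemma acceleration_side_flat (rho : R) (v a : R -> R -> vec3) :
  admissible_velocity flat_param rho v ->
  admissible_acceleration flat_param rho v a ->
  forall y z, y = -1 \/ y = 1 -> 0 < z < rho -> vy (a y z) = - y * vx (v y z) ^ 2.
Proof.
intros Hv (_ & _ & H) y z hy hz.
assert (hv := velocity_side_flat rho v Hv y z hy hz).
assert (E : vdot (a y z) (radial (flat_param y z))
            = Rabs (vdot (v y z) e_z) ^ 2 - vnorm (v y z) ^ 2).
{ apply H.
  - split; [split; [destruct hy; subst; lra | lra] | tauto].
  - rewrite wires_flat; lra. }
unfold vnorm in E; rewrite pow2_abs, pow2_sqrt in E by apply vdot_self_ge_0.
unfold vdot, radial, flat_param, e_z in E; simpl in E; rewrite hv in E.
destruct hy; subst; lra.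
Qed.

Lemma flat_in_class_A (rho : R) :
  0 < rho -> in_class_A_via flat_param rho (flat_surface rho).
Proof.
intros hrho.
split; [| split; [| split; [| split; [| split]]]].
- split; [exact (C2_const 0) | split].
  + apply (C2_scalar_ext (fun y z => y * 1)); [intros; simpl; ring |].
    apply (C2_tensor (fun y => y) (fun _ => 1) (fun _ => 0)
             (fun _ => 1) (fun _ => 0) (fun _ => 0));
      intros; first [apply continuous_const | exact (is_derive_const _ _) | apply (is_derive_id y)].
  + apply (C2_scalar_ext (fun y z => 1 * z)); [intros; simpl; ring |].
    apply (C2_tensor (fun _ => 1) (fun _ => 0) (fun _ => 0)
             (fun z => z) (fun _ => 1) (fun _ => 0));
      intros; first [apply continuous_const | exact (is_derive_const _ _) | apply (is_derive_id z)].
- intros y z y' z' _ _ e; injection e; auto.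
- intros y z _; rewrite normal_vector_flat; intros e; injection e; lra.
- intros p; split.
  + intros (y & z & hy & hz & ->); exists y, z; repeat split; tauto.
  + intros (y & z & (hy & hz) & <-); exists y, z; repeat split; tauto.
- intros p [[s [hs ->]] | [s [hs ->]]]; apply Rabs_le_between in hs.
  + exists s, 0; split; [split; [split; lra | auto] | reflexivity].
  + exists s, rho; split; [split; [split; lra | auto] | reflexivity].
- intros p (y & z & [[hy hz] hb] & <-) hw; rewrite wires_flat in hw.
  unfold cylinder, flat_param; simpl; split; [| exact hz].
  destruct hb as [-> | [-> | hb]]; [ring | ring | tauto].
Qed.

Lemma flat_critical (rho sigma : R) :
  0 < rho -> critical_point flat_param rho sigma.
Proof.
intros hrho v Hv; assert (Hside := velocity_side_flat rho v Hv).
destruct Hv as ((_ & C2 & C3) & Ht & _).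
assert (Hw := tangential_flat rho v hrho Ht).
assert (D2 := is_C1_of_C2 _ C2); assert (D3 := is_C1_of_C2 _ C3).
rewrite surface_integral_flat.
rewrite (rect_int_ext _ (fun y z => sigma * (partial_y (fun y z => vy (v y z)) y z
          + partial_z (fun y z => vz (v y z)) y z)))
  by (intros; rewrite surface_div_flat; reflexivity).
rewrite rect_int_scal; [| lra | intros; apply continuity_2d_pt_plus; [apply D2 | apply D3]].
rewrite (divergence_theorem _ _ _ _ _ _ (-1) 1 0 rho ltac:(lra) D2 D3).
rewrite (RInt_ext _ (fun _ => 0)), (RInt_ext (fun y => vz (v y rho) - vz (v y 0)) (fun _ => 0)),
  !RInt_const.
- unfold scal; simpl; unfold mult; simpl; ring_R.
- intros y hy; rewrite Rmin_left, Rmax_right in hy by lra.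
  rewrite (proj2 (Hw y rho ltac:(lra) ltac:(auto))).
  rewrite (proj2 (Hw y 0 ltac:(lra) ltac:(auto))); ring_R.
- intros z hz; rewrite Rmin_left, Rmax_right in hz by lra.
  rewrite !Hside by (auto || lra); ring_R.
Qed.

(** The Jacobian determinant v2_y v3_z - v2_z v3_y is the divergence of
    (v2 v3_z, - v2 v3_y) since the mixed derivatives of [v3] agree.  Together with
    div a it is integrated by the divergence theorem; the flux through the sides
    comes from [a] alone, and there is none through the wires. *)
Lemma second_variation_flat (rho sigma : R) (v a : R -> R -> vec3) :
  0 < rho ->
  admissible_velocity flat_param rho v ->
  admissible_acceleration flat_param rho v a ->
  let u := fun y z => vx (v y z) in
  second_variation flat_param rho sigma v a =
  sigma * (rect_int (-1) 1 0 rho (fun y z => partial_y u y z ^ 2 + partial_z u y z ^ 2)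
           - RInt (fun z => u 1 z ^ 2 + u (-1) z ^ 2) 0 rho).
Proof.
intros hrho Hv Ha u.
assert (Hvs := velocity_side_flat rho v Hv).
assert (Has := acceleration_side_flat rho v a Hv Ha).
destruct Hv as ((C1 & C2 & C3) & Ht & _), Ha as ((_ & A2 & A3) & Hat & _).
assert (Hw := tangential_flat rho v hrho Ht).
assert (Haw := tangential_flat rho a hrho Hat).
fold u in C1; set (v2 := fun y z => vy (v y z)) in *; set (v3 := fun y z => vz (v y z)) in *.
set (a2 := fun y z => vy (a y z)) in *; set (a3 := fun y z => vz (a y z)) in *.
assert (D1 := is_C1_of_C2 _ C1); assert (D2 := is_C1_of_C2 _ C2).
assert (D3y := is_C1_partial_y _ C3); assert (D3z := is_C1_partial_z _ C3).
assert (DA2 := is_C1_of_C2 _ A2); assert (DA3 := is_C1_of_C2 _ A3).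
assert (P := is_C1_plus _ _ _ _ _ _
               (is_C1_mult _ _ _ _ _ _ (is_C1_const 2) (is_C1_mult _ _ _ _ _ _ D2 D3z)) DA2).
assert (Q := is_C1_plus _ _ _ _ _ _
               (is_C1_mult _ _ _ _ _ _ (is_C1_const (- 2)) (is_C1_mult _ _ _ _ _ _ D2 D3y)) DA3).
assert (G := divergence_theorem _ _ _ _ _ _ (-1) 1 0 rho ltac:(lra) P Q).
assert (Cg : forall y z,
  continuity_2d_pt (fun y z => partial_y u y z ^ 2 + partial_z u y z ^ 2) y z).
{ intros; apply continuity_2d_pt_plus; apply continuity_2d_pt_sq; apply D1. }
(* The field (2 v2 v3_z + a2, - 2 v2 v3_y + a3), whose divergence is
   [py + qz]. *)
set (py := fun y z => _ + partial_y a2 y z) in P.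
set (qz := fun y z => _ + partial_z a3 y z) in Q.
assert (Cpq : forall y z, continuity_2d_pt (fun y z => py y z + qz y z) y z).
{ intros; apply continuity_2d_pt_plus; [apply P | apply Q]. }
change (rect_int (-1) 1 0 rho (fun y z => py y z + qz y z) =
  RInt (fun z => (2 * (v2 1 z * partial_z v3 1 z) + a2 1 z)
    - (2 * (v2 (-1) z * partial_z v3 (-1) z) + a2 (-1) z)) 0 rho
  + RInt (fun y => (- 2 * (v2 y rho * partial_y v3 y rho) + a3 y rho)
    - (- 2 * (v2 y 0 * partial_y v3 y 0) + a3 y 0)) (-1) 1) in G.
rewrite (RInt_ext _ (fun z => - (u 1 z ^ 2 + u (-1) z ^ 2))) in G.
2: { intros z hz; rewrite Rmin_left, Rmax_right in hz by lra.
     change (v2 1 z) with (vy (v 1 z)); change (v2 (-1) z) with (vy (v (-1) z)).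
     change (a2 1 z) with (vy (a 1 z)); change (a2 (-1) z) with (vy (a (-1) z)).
     rewrite !Hvs, !Has by (auto || lra); unfold u; ring_R. }
rewrite (RInt_ext (fun y => _ - _) (fun _ => 0)), RInt_const in G.
2: { intros y hy; rewrite Rmin_left, Rmax_right in hy by lra.
     change (a3 y rho) with (vz (a y rho)); change (a3 y 0) with (vz (a y 0)).
     rewrite (proj2 (Haw y rho ltac:(lra) ltac:(auto))).
     rewrite (proj2 (Haw y 0 ltac:(lra) ltac:(auto))).
     assert (E : forall z, z = 0 \/ z = rho -> partial_y v3 y z = 0).
     { intros z hz; apply (Derive_zero_inside _ (-1) 1); [| lra].
       intros s hs; apply Hw; assumption. }
     rewrite !E by auto; ring_R. }
unfold second_variation; rewrite surface_integral_flat.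
rewrite (rect_int_ext _ (fun y z => sigma *
  ((partial_y u y z ^ 2 + partial_z u y z ^ 2) + (py y z + qz y z)))).
2: { intros y z; rewrite second_variation_density_flat, surface_div_flat.
     fold u v2 v3 a2 a3; unfold py, qz.
     rewrite (partial_comm v3 y z C3); ring_R. }
rewrite rect_int_scal by (lra || (intros; apply continuity_2d_pt_plus; auto)).
rewrite rect_int_plus by (lra || auto).
rewrite G; f_equal.
assert (Eo : RInt (fun z => - (u 1 z ^ 2 + u (-1) z ^ 2)) 0 rho
             = - RInt (fun z => u 1 z ^ 2 + u (-1) z ^ 2) 0 rho).
{ apply (RInt_opp (fun z => u 1 z ^ 2 + u (-1) z ^ 2)).
  apply (ex_RInt_continuous (fun z => u 1 z ^ 2 + u (-1) z ^ 2)); intros z _.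
  apply continuous_Rplus; apply continuous_Rsq; apply continuous_slice_z; apply D1. }
rewrite Eo; unfold scal; simpl; unfold mult; simpl; ring_R.
Qed.

(** * The critical mode *)

Definition critical_mode (k y z : R) : R := cosh (k * y) * sin (k * z).

Lemma is_derive_cosh_lin (k y : R) : is_derive (fun s => cosh (k * s)) y (k * sinh (k * y)).
Proof. auto_derive; [exact I | ring]. Qed.

Lemma is_derive_sinh_lin (k y : R) :
  is_derive (fun s => k * sinh (k * s)) y (k ^ 2 * cosh (k * y)).
Proof. auto_derive; [exact I | ring]. Qed.

Lemma is_derive_sin_lin (k z : R) : is_derive (fun s => sin (k * s)) z (k * cos (k * z)).
Proof. auto_derive; [exact I | ring]. Qed.

Lemma is_derive_cos_lin (k z : R) :
  is_derive (fun s => k * cos (k * s)) z (- k ^ 2 * sin (k * z)).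
Proof. auto_derive; [exact I | ring]. Qed.

(** The mode w is harmonic, so |grad w|^2 is the divergence of w grad w, whose flux
    through the sides is 2 k sinh k cosh k times the integral of sin(k z)^2. *)
Lemma critical_mode_energy (k rho : R) :
  sin (k * rho) = 0 ->
  rect_int (-1) 1 0 rho (fun y z =>
    partial_y (critical_mode k) y z ^ 2 + partial_z (critical_mode k) y z ^ 2)
  - RInt (fun z => critical_mode k 1 z ^ 2 + critical_mode k (-1) z ^ 2) 0 rho
  = 2 * cosh k * (k * sinh k - cosh k) * RInt (fun z => sin (k * z) ^ 2) 0 rho.
Proof.
intros hs.
assert (Cc : forall x, continuous (fun y => k ^ 2 * cosh (k * y)) x).
{ apply continuous_of_derive_everywhere; intros x; auto_derive; exact I. }
assert (Cs : forall x, continuous (fun y => - k ^ 2 * sin (k * y)) x).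
{ apply continuous_of_derive_everywhere; intros x; auto_derive; exact I. }
assert (Csh : forall x, continuous (fun y => k * sinh (k * y)) x).
{ apply continuous_of_derive_everywhere; intros x; auto_derive; exact I. }
assert (Cco : forall x, continuous (fun y => k * cos (k * y)) x).
{ apply continuous_of_derive_everywhere; intros x; auto_derive; exact I. }
assert (U := is_C1_tensor _ _ _ _ (is_derive_cosh_lin k) Csh (is_derive_sin_lin k) Cco).
assert (Uy := is_C1_tensor _ _ _ _ (is_derive_sinh_lin k) Cc (is_derive_sin_lin k) Cco).
assert (Uz := is_C1_tensor _ _ _ _ (is_derive_cosh_lin k) Csh (is_derive_cos_lin k) Cs).
assert (E := divergence_theorem _ _ _ _ _ _ (-1) 1 0 rho ltac:(lra)
               (is_C1_mult _ _ _ _ _ _ U Uy) (is_C1_mult _ _ _ _ _ _ U Uz)).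
rewrite (rect_int_ext _ (fun y z =>
  partial_y (critical_mode k) y z ^ 2 + partial_z (critical_mode k) y z ^ 2)) in E.
2: { intros y z.
     assert (ey : partial_y (critical_mode k) y z = k * sinh (k * y) * sin (k * z))
       by (apply is_derive_unique; apply (U y z)).
     assert (ez : partial_z (critical_mode k) y z = cosh (k * y) * (k * cos (k * z)))
       by (apply is_derive_unique; apply (U y z)).
     rewrite ey, ez; ring. }
assert (e_sin : ex_RInt (fun z => sin (k * z) ^ 2) 0 rho).
{ apply (ex_RInt_continuous (fun z => sin (k * z) ^ 2)); intros z _.
  apply (ex_derive_continuous (fun z => sin (k * z) ^ 2)); auto_derive; exact I. }
assert (scal_sin : forall c (f : R -> R), (forall z, f z = c * sin (k * z) ^ 2) ->
          RInt f 0 rho = c * RInt (fun z => sin (k * z) ^ 2) 0 rho).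
{ intros c f Hf; rewrite (RInt_ext f (fun z => scal c (sin (k * z) ^ 2))) by (intros; apply Hf).
  apply (RInt_scal (fun z => sin (k * z) ^ 2)); exact e_sin. }
assert (hc : cosh (k * -1) = cosh k).
{ replace (k * -1) with (- k) by ring; apply cosh_even. }
assert (hh : sinh (k * -1) = - sinh k).
{ replace (k * -1) with (- k) by ring; apply sinh_odd. }
rewrite (scal_sin (2 * (cosh k * (k * sinh k)))) in E
.
2: { intros z; cbv beta. rewrite hc, hh, !Rmult_1_r; ring. }
rewrite (RInt_ext (fun y => _ - _) (fun _ => 0)), RInt_const in E
  by (intros; cbv beta; rewrite Rmult_0_r, sin_0, hs; ring_R).
rewrite E, (scal_sin (2 * cosh k ^ 2) (fun z => critical_mode k 1 z ^ 2 + critical_mode k (-1) z ^ 2))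
  by (intros; unfold critical_mode; rewrite hc, !Rmult_1_r; ring).
unfold scal; simpl; unfold mult; simpl; ring.
Qed.

Lemma critical_mode_admissible (k rho : R) :
  sin (k * rho) = 0 ->
  admissible_velocity flat_param rho (fun y z => mkvec (critical_mode k y z) 0 0).
Proof.
intros hs; split; [split; [| split; exact (C2_const 0)] | split].
- apply (C2_tensor (fun y => cosh (k * y)) (fun y => k * sinh (k * y))
    (fun y => k ^ 2 * cosh (k * y)) (fun z => sin (k * z)) (fun z => k * cos (k * z))
    (fun z => - k ^ 2 * sin (k * z))).
  + apply is_derive_cosh_lin.
  + apply is_derive_sinh_lin.
  + apply continuous_of_derive_everywhere; intros x; auto_derive; exact I.
  + apply is_derive_sin_lin.
  + apply is_derive_cos_lin.
  + apply continuous_of_derive_everywhere; intros x; auto_derive; exact I.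
- intros y z _ hw; apply wires_flat in hw.
  assert (e : critical_mode k y z = 0).
  { unfold critical_mode; destruct hw as [_ [-> | ->]];
      [rewrite Rmult_0_r, sin_0 | rewrite hs]; ring. }
  rewrite e; unfold vscale, vdot, wire_tangent, e_y; simpl; f_equal; ring.
- intros y z _ _; unfold vdot, radial, flat_param; simpl; ring.
Qed.

(** Any extension of the prescribed values - y cosh(k)^2 sin(k z)^2 on the sides
    y = 1 and y = -1 will do; this one is linear in [y]. *)
Lemma critical_mode_acceleration (k rho : R) :
  admissible_acceleration flat_param rho (fun y z => mkvec (critical_mode k y z) 0 0)
    (fun y z => mkvec 0 (y * (- cosh k ^ 2 * sin (k * z) ^ 2)) 0).
Proof.
split; [split; [exact (C2_const 0) | split; [| exact (C2_const 0)]] | split].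
- apply (C2_tensor (fun y => y) (fun _ => 1) (fun _ => 0)
    (fun z => - cosh k ^ 2 * sin (k * z) ^ 2)
    (fun z => - cosh k ^ 2 * (2 * (k * (sin (k * z) * cos (k * z)))))
    (fun z => - cosh k ^ 2 * (2 * (k ^ 2 * (cos (k * z) ^ 2 - sin (k * z) ^ 2))))).
  + intros y; apply (is_derive_id y).
  + intros y; exact (is_derive_const _ _).
  + intros y; apply continuous_const.
  + intros z; auto_derive; [exact I | ring].
  + intros z; auto_derive; [exact I | ring].
  + apply continuous_of_derive_everywhere; intros x; auto_derive; exact I.
- intros y z _ _; unfold vscale, vdot, wire_tangent, e_y; simpl; f_equal; ring.
- intros y z [[hy hz] hb] hw; rewrite wires_flat in hw.
  unfold vnorm; rewrite pow2_abs, pow2_sqrt by apply vdot_self_ge_0.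
  unfold vdot, radial, flat_param, e_z, critical_mode; simpl.
  destruct hb as [-> | [-> | hb]]; [| | tauto].
  + replace (k * -1) with (- k) by ring.
    rewrite cosh_even; ring.
  + replace (k * 1) with k by ring; ring.
Qed.

(** * The stability criterion *)

Theorem proposition4p1 (rho sigma : R) (hrho : 0 < rho) (hsigma : 0 < sigma) :
  in_class_A_via flat_param rho (flat_surface rho) /\
  critical_point flat_param rho sigma /\
  (second_variation_stable flat_param rho sigma <->
     1 <= PI / rho * tanh (PI / rho)).
Proof.
split; [now apply flat_in_class_A | split; [now apply flat_critical |]].
assert (hPI := PI_RGT_0).
set (k := PI / rho).
assert (hk : 0 < k) by (apply Rdiv_lt_0_compat; lra).
assert (hkr : k * rho = PI) by (unfold k; field; lra).
split.
- intros H.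
  assert (hs : sin (k * rho) = 0) by (rewrite hkr; apply sin_PI).
  assert (Hv := critical_mode_admissible k rho hs).
  assert (Ha := critical_mode_acceleration k rho).
  specialize (H _ _ Hv Ha).
  rewrite (second_variation_flat rho sigma _ _ hrho Hv Ha) in H; cbv zeta in H.
  cbn [vx] in H.
  change (fun y z => critical_mode k y z) with (critical_mode k) in H.
  rewrite (critical_mode_energy k rho hs) in H.
  assert (hc := cosh_gt_0 k).
  assert (hS : 0 < RInt (fun z => sin (k * z) ^ 2) 0 rho).
  { apply RInt_gt_0; [exact hrho | |].
    - intros z hz; apply pow_lt, sin_gt_0; [nra |]; rewrite <- hkr; nra.
    - intros z _; apply (ex_derive_continuous (fun z => sin (k * z) ^ 2)).
      auto_derive; exact I. }
  set (S := RInt _ _ _) in *.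
  assert (h : 0 <= k * sinh k - cosh k).
  { apply Rnot_lt_le; intros hn.
    assert (h1 : 0 < 2 * sigma * cosh k * S)
      by (apply Rmult_lt_0_compat; [apply Rmult_lt_0_compat; lra | exact hS]).
    assert (h2 := Rmult_lt_compat_l _ _ _ h1 hn); lra. }
  unfold tanh; apply (Rmult_le_reg_r (cosh k)); [exact hc |].
  replace (k * (sinh k / cosh k) * cosh k) with (k * sinh k) by (field; lra).
  lra.
- intros H v a Hv Ha.
  rewrite (second_variation_flat rho sigma v a hrho Hv Ha); cbv zeta.
  assert (D := is_C1_of_C2 _ (proj1 (proj1 Hv))).
  set (u := fun y z => vx (v y z)) in *.
  assert (T := trace_inequality u _ _ rho hrho D).
  fold k in T.
  apply Rmult_le_pos; [lra |].
  assert (hB : 0 <= RInt (fun z => u 1 z ^ 2 + u (-1) z ^ 2) 0 rho).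
  { apply RInt_ge_0; [lra | |].
    - apply (ex_RInt_continuous (fun z => u 1 z ^ 2 + u (-1) z ^ 2)); intros z _.
      apply continuous_Rplus; apply continuous_Rsq; apply continuous_slice_z; apply D.
    - intros z _; assert (h1 := pow2_ge_0 (u 1 z)); assert (h2 := pow2_ge_0 (u (-1) z)); lra. }
  assert (Hw := tangential_flat rho v hrho (proj1 (proj2 Hv))).
  specialize (T (fun y hy => conj (proj1 (Hw y 0 hy (or_introl eq_refl)))
                               (proj1 (Hw y rho hy (or_intror eq_refl))))).
  assert (h := Rmult_le_compat_r _ _ _ hB H).
  rewrite Rmult_1_l in h; apply Rge_le, Rge_minus, Rle_ge.
  exact (Rle_trans _ _ _ h T).
Qed.
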